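(* Let $N$ be a Poisson process with unit rate. Then for all $R,T>0$, $$\mathbb P\left(\frac1{T^2}\int_0^TN_t\,dt-\frac12\ge R\right)\le\exp\left(-\frac T3\,h(3R)\right)\le\exp\left(-\frac{3R^2T}{2(1+R)}\right),$$ where $h(x)=(1+x)\log(1+x)-x$. *)

(* Defs.v *)
From HB Require Import structures.
From mathcomp Require Import all_boot all_order all_algebra.
From mathcomp Require Import all_classical all_reals all_analysis.

Set Implicit Arguments.
Unset Strict Implicit.
Unset Printing Implicit Defensive.

Import Order.TTheory GRing.Theory Num.Theory.
Import numFieldNormedType.Exports.

Local Open Scope classical_set_scope.
Local Open Scope ring_scope.

(* Taking A i := setT for the indices i outside a subfamily recovers the product
   rule for that subfamily. *)
Definition mutually_independent (d d' : measure_display)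
    (Omega : measurableType d) (E : measurableType d') (R : realType)
    (P : probability Omega R) (I : finType) (X : I -> Omega -> E) : Prop :=
  forall A : I -> set E, (forall i, measurable (A i)) ->
    P (\bigcap_i (X i @^-1` A i)) = (\prod_i P (X i @^-1` A i))%E.

(* The time set is [0, +oo[: the random variables N t with t < 0 are
   unconstrained and play no role. Paths are nondecreasing, so the truncated
   subtraction of nat gives the genuine increments. *)
Record poisson_process (d : measure_display) (Omega : measurableType d)
    (R : realType) (P : probability Omega R) (rate : R)
    (N : R -> {RV P >-> nat}) : Prop := PoissonProcess {
  poisson_process_start : {ae P, forall w, N 0 w = 0%N} ;
  poisson_process_nondecreasing :
    forall (w : Omega) (s t : R), 0 <= s -> s <= t -> (N s w <= N t w)%N ;
  poisson_process_right_continuous :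
    forall (w : Omega) (t : R), 0 <= t -> N s w @[s --> t^'+] --> N t w ;
  poisson_process_independent_increments :
    forall (n : nat) (t : nat -> R), 0 <= t 0%N ->
      (forall i, (i < n)%N -> t i < t i.+1) ->
      mutually_independent P
        (fun (i : 'I_n) (w : Omega) => (N (t i.+1) w - N (t i) w)%N) ;
  poisson_process_increment_law :
    forall (s t : R) (k : nat), 0 <= s -> s < t ->
      P [set w | (N t w - N s w)%N = k] =
        (poisson_pmf (rate * (t - s)) k)%:E
}.

Definition bennett_h (R : realType) (x : R) : R := (1 + x) * ln (1 + x) - x.

(* Main.v *)
Require Import Defs.
From HB Require Import structures.
From mathcomp Require Import all_boot all_order all_algebra.
From mathcomp Require Import all_classical all_reals all_analysis.
From mathcomp Require Import measurable_realfun.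
From mathcomp Require Import ring lra.

(** The proof is Chernoff's method. Write I for the integral of N over [0, T].
Cutting [0, T] into n equal steps, the upper Riemann sum of the nondecreasing
path dominates I, and summation by parts turns it into a combination of the
increments of N with weights T/n, 2T/n, ..., T, the first increment having the
largest weight. The increments are independent Poisson variables of parameter
T/n, and a Poisson variable of parameter m has exponential moments
exp(m (e^a - 1)), so the exponential moment of the upper sum, at the parameter
l/T, is the exponential of T (S_n - 1), where S_n is an upper Riemann sum of
the integral of e^(l x) over [0, 1], itself a geometric sum that is at most
e^(l/n) (e^l - 1)/l (poisson_upper_sum_mgf). Letting n grow, Markov's
inequality gives, for every l > 0,
  P(I/T >= c) <= exp(T ((e^l - 1)/l - 1) - l c)     (poisson_integral_tail).

The rest is one inequality about the exponential, expR_le_pade: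
  (3 - x) e^x <= 3 + 2 x + x^2/2     for x >= 0.
Read in one way, it says (e^l - 1)/l - 1 - l/2 <= (e^l - 1 - l)/3, which
replaces the exponent above, for c = T (r + 1/2), by
  (T/3) (e^l - 1 - l - 3 r l);
the minimum of this is -(T/3) h(3r), reached at l = ln(1 + 3r). Read in the
other way, it bounds e^l - 1 - l by l^2 / (2 (1 - l/3)) for l < 3; since h is
the convex conjugate of e^l - 1 - l, this gives h(x) >= x^2 / (2 (1 + x/3)),
which is the second half of the statement at x = 3r.

Paths are handled through upper sums also because they show, by passing to the
limit, that I is a random variable, so that the tail event is measurable. *)

Set Implicit Arguments.
Unset Strict Implicit.

Import Order.TTheory GRing.Theory Num.Theory.
Import numFieldNormedType.Exports.

Local Open Scope classical_set_scope.
Local Open Scope ring_scope.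

(** * Inequalities for the exponential and for h *)

Lemma ge0_derive_le (R : realType) (f f' : R -> R) (x : R) :
  (forall y : R, is_derive y 1 f (f' y)) -> (forall y, 0 <= y -> 0 <= f' y) ->
  0 <= x -> f 0 <= f x.
Proof.
move=> df f'0 x0; apply: (@ger0_derive1_ndecry R f 0) => //.
- move=> y; rewrite in_itv/= andbT => y0.
  by rewrite derive1E derive_val f'0// ltW.
- apply: continuous_subspaceT => y.
  exact/differentiable_continuous/derivable1_diffP.
Qed.

Lemma expR_ge_taylor2 (R : realType) (x : R) :
  0 <= x -> 1 + x + x ^+ 2 / 2 <= expR x.
Proof.
pose f (y : R) := expR y - (1 + y + y ^+ 2 / 2).
have df (y : R) : is_derive y 1 f (expR y - (1 + y)).
  by apply: is_derive_eq; rewrite /GRing.scale/=; field.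
move/(ge0_derive_le df); rewrite /f expR0 expr0n/= mul0r !addr0 subrr subr_ge0.
by apply=> y y0; rewrite subr_ge0 expR_ge1Dx.
Qed.

(** The quotient of the right-hand side by 3 - x is the [2/1] Padé approximant
of the exponential. Multiplying by e^(-x) leaves a function whose derivative is
1 - (1 + x + x^2/2) e^(-x), nonnegative by the Taylor bound. *)
Lemma expR_le_pade (R : realType) (x : R) :
  0 <= x -> (3 - x) * expR x <= 3 + 2 * x + x ^+ 2 / 2.
Proof.
move=> x0.
pose f (y : R) := (3 + 2 * y + y ^+ 2 / 2) * expR (- y) + y.
have df (y : R) :
    is_derive y 1 f (1 - (1 + y + y ^+ 2 / 2) * expR (- y)).
  by apply: is_derive_eq; rewrite /GRing.scale/=; field.
have : f 0 <= f x.
  apply: (ge0_derive_le df) => // y y0.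
  by rewrite subr_ge0 expRN ler_pdivrMr ?expR_gt0// mul1r expR_ge_taylor2.
rewrite /f oppr0 expR0 expr0n/= => f0x.
rewrite -ler_pdivlMr ?expR_gt0// -expRN; lra.
Qed.

(** Young's inequality for the convex conjugate h of e^l - 1 - l: it is the
tangent inequality for the exponential at ln(1 + x). *)
Lemma bennett_h_ge_dual (R : realType) (x l : R) :
  0 <= x -> l * x - (expR l - 1 - l) <= bennett_h x.
Proof.
move=> x0; have x1 : 0 < 1 + x by lra.
have := expR_ge1Dx (l - ln (1 + x)).
rewrite expRB lnK// ler_pdivlMr// /bennett_h; lra.
Qed.

(** Bernstein's lower bound: the dual inequality at a rational l, where the
Padé bound on e^l makes the estimate rational in x. *)
Lemma bennett_h_ge (R : realType) (x : R) :
  0 <= x -> x ^+ 2 / (2 * (1 + x / 3)) <= bennett_h x.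
Proof.
move=> x0; set D := 1 + x / 3; have D0 : 0 < D by rewrite /D; lra.
(* For l = x / D one has 1 - l/3 = 1 / D, so that l x - l^2 / (2 (1 - l/3)) is
   exactly x^2 / (2 D). *)
apply: le_trans (bennett_h_ge_dual (x / D) x0).
have l0 : 0 <= x / D by rewrite divr_ge0// ltW.
have l3 : 3 - x / D = 3 / D by rewrite /D; field; rewrite /D in D0; lra.
have := expR_le_pade l0; rewrite l3.
move: (expR (x / D)) => E.
rewrite mulrAC ler_pdivrMr// => HE.
have xE : x = 3 * (D - 1) by rewrite /D; field.
rewrite -subr_ge0.
suff -> : x / D * x - (E - 1 - x / D) - x ^+ 2 / (2 * D) =
   ((3 + 2 * (x / D) + (x / D) ^+ 2 / 2) * D - 3 * E) / 3.
  by rewrite divr_ge0// subr_ge0.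
rewrite xE; field; lra.
Qed.

(** The left-hand side is E e^(l U) - 1 - l E U for U uniform on [0, 1]. Term by
term in the power series, l^k / (k+1)! <= (l^k / k!) / 3 for k >= 2, and the
Padé bound packages all these comparisons at once. *)
Lemma uniform_mgf_le (R : realType) (l : R) : 0 < l ->
  (expR l - 1) / l - 1 - l / 2 <= (expR l - 1 - l) / 3.
Proof.
move=> l0; have := expR_le_pade (ltW l0) => H.
rewrite -subr_ge0.
suff -> : (expR l - 1 - l) / 3 - ((expR l - 1) / l - 1 - l / 2) =
   (3 + 2 * l + l ^+ 2 / 2 - (3 - l) * expR l) / (3 * l).
  by rewrite divr_ge0 ?subr_ge0//; lra.
field; lra.
Qed.

(** Upper Riemann sum of the integral of e^(l x) over [0, 1]: the sum is
geometric, and its ratio q satisfies q - 1 >= l / n.+1. *)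
Lemma upper_riemann_expR_le (R : realType) (l : R) (n : nat) : 0 < l ->
  (\sum_(j < n.+1) expR (l * j.+1%:R / n.+1%:R)) / n.+1%:R
    <= expR (l / n.+1%:R) * ((expR l - 1) / l).
Proof.
move=> l0; set q := expR (l / n.+1%:R).
have qX k : expR (l * k%:R / n.+1%:R) = q ^+ k.
  by rewrite -expRM_natl; congr expR; ring.
under eq_bigr do rewrite qX exprS.
rewrite -mulr_sumr -mulrA ler_pM2l ?expR_gt0// ler_pdivlMr//.
have -> : expR l = q ^+ n.+1 by rewrite -qX mulfK.
rewrite subrX1 mulrAC -mulrA [leRHS]mulrC ler_wpM2l//.
  by apply: sumr_ge0 => i _; rewrite exprn_ge0// expR_ge0.
by rewrite lerBrDl expR_ge1Dx.
Qed.

(** * Riemann sums of nondecreasing functions *)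

Definition upper_sum (R : realType) (f : R -> R) (T : R) (n : nat) : R :=
  T / n.+1%:R * \sum_(i < n.+1) f (T * i.+1%:R / n.+1%:R).

Lemma integrable_nondecreasing (R : realType) (f : R -> R) (a b : R) :
  {in `[a, b] &, {homo f : x y / x <= y}} ->
  (@lebesgue_measure R).-integrable `[a, b] (EFin \o f).
Proof.
move=> ndf; have [ab|ba] := leP a b; last first.
  by rewrite set_itv_ge ?integrable_set0// bnd_simp -ltNge.
have aE : a \in `[a, b] by rewrite in_itv/= lexx.
have bE : b \in `[a, b] by rewrite in_itv/= lexx andbT.
(* Outside [a, b] nothing is known of f; composing with the projection onto
   [a, b] gives a function that is monotone on the whole line. *)
pose clamp x := Order.min (Order.max x a) b.
have clampE x : clamp x \in `[a, b].
  by rewrite in_itv/= /clamp le_min le_max lexx orbT ab/= ge_min lexx orbT.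
have clamp_id x : x \in `[a, b] -> clamp x = x.
  by rewrite in_itv/= /clamp => /andP[ax xb]; rewrite max_l// min_l.
have mf : measurable_fun `[a, b] f.
  apply: (eq_measurable_fun (f \o clamp)).
    by move=> x; rewrite inE/= => /clamp_id ->.
  apply: nondecreasing_measurable => // x y xy /=; apply: ndf => //.
  by rewrite /clamp le_min2// le_max2.
apply: measurable_bounded_integrable => //.
  by rewrite /= lebesgue_measure_itv/=; case: ifP => // _; rewrite -EFinB ltry.
exists (Order.max `|f a| `|f b|); split; first exact: num_real.
move=> M HM x /= xE; apply: ltW; apply: le_lt_trans HM.
have fax : f a <= f x by apply: ndf => //; move: xE; rewrite in_itv/= => /andP[].
have fxb : f x <= f b by apply: ndf => //; move: xE; rewrite in_itv/= => /andP[].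
rewrite ler_norml; apply/andP; split.
  rewrite (le_trans _ fax)// lerNl (le_trans (ler_norm _))// normrN.
  by rewrite le_max lexx.
by rewrite (le_trans fxb)// (le_trans (ler_norm _))// le_max lexx orbT.
Qed.

Lemma Rintegral_nondecreasing_bounds1 (R : realType) (f : R -> R) (a b : R) :
  a <= b -> {in `[a, b] &, {homo f : x y / x <= y}} ->
  (b - a) * f a <= \int[lebesgue_measure]_(x in `]a, b]) f x <= (b - a) * f b.
Proof.
move=> ab ndf.
have len c : \int[lebesgue_measure]_(x in `]a, b]) c = (b - a) * c.
  rewrite Rintegral_cst//= lebesgue_measure_itv/= lte_fin mulrC.
  move: ab; rewrite le_eqVlt => /orP[/eqP ->|ab'].
    by rewrite ltxx subrr.
  by rewrite ab'.
have sub : `]a, b] `<=` `[a, b] by apply: subset_itvr; rewrite bnd_simp.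
have int (g : R -> R) : {in `[a, b] &, {homo g : x y / x <= y}} ->
    (@lebesgue_measure R).-integrable `]a, b] (EFin \o g).
  by move=> /integrable_nondecreasing; apply: integrableS.
rewrite -!len; apply/andP; split; apply: le_Rintegral => //.
- by apply: int => x y _ _.
- exact: int.
- move=> x xE; apply: ndf; first by rewrite in_itv/= lexx.
    exact: sub.
  by move: xE; rewrite /= in_itv/= => /andP[/ltW].
- exact: int.
- by apply: int => x y _ _.
- move=> x xE; apply: ndf; first exact: sub.
    by rewrite in_itv/= lexx andbT.
  by move: xE; rewrite /= in_itv/= => /andP[].
Qed.

Lemma Rintegral_nondecreasing_bounds (R : realType) (f : R -> R) (t : nat -> R)
    (n : nat) :
  {homo t : i j / (i <= j)%N >-> i <= j} ->
  {in `[t 0%N, t n] &, {homo f : x y / x <= y}} ->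
  \sum_(i < n) (t i.+1 - t i) * f (t i)
    <= \int[lebesgue_measure]_(x in `[t 0%N, t n]) f x
    <= \sum_(i < n) (t i.+1 - t i) * f (t i.+1).
Proof.
move=> ndt; elim: n => [|n IHn] ndf.
  by rewrite !big_ord0 set_itv1 Rintegral_set1 lexx.
have tn0 : t 0%N <= t n by exact: ndt.
have tS : t n <= t n.+1 by exact: ndt.
have int := integrable_nondecreasing ndf.
have split_last : \int[lebesgue_measure]_(x in `[t 0%N, t n.+1]) f x =
    \int[lebesgue_measure]_(x in `[t 0%N, t n]) f x +
    \int[lebesgue_measure]_(x in `]t n, t n.+1]) f x.
  by rewrite -(@Rintegral_itvB _ _ _ _ (t n) int)// ?bnd_simp// addrC subrK.
have /andP[lo hi] : \sum_(i < n) (t i.+1 - t i) * f (t i)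
    <= \int[lebesgue_measure]_(x in `[t 0%N, t n]) f x
    <= \sum_(i < n) (t i.+1 - t i) * f (t i.+1).
  apply: IHn => x y xE yE; apply: ndf.
    by apply: subset_itvl xE; rewrite bnd_simp.
  by apply: subset_itvl yE; rewrite bnd_simp.
have /andP[lo1 hi1] : (t n.+1 - t n) * f (t n)
    <= \int[lebesgue_measure]_(x in `]t n, t n.+1]) f x
    <= (t n.+1 - t n) * f (t n.+1).
  apply: Rintegral_nondecreasing_bounds1 => // x y xE yE; apply: ndf.
    by apply: subset_itvr xE; rewrite bnd_simp.
  by apply: subset_itvr yE; rewrite bnd_simp.
by rewrite split_last 2!big_ord_recr/= !lerD.
Qed.

Lemma upper_sum_bounds (R : realType) (f : R -> R) (T : R) (n : nat) :
  0 <= T -> {in `[0, T] &, {homo f : x y / x <= y}} ->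
  upper_sum f T n - T * (f T - f 0) / n.+1%:R
    <= \int[lebesgue_measure]_(x in `[0, T]) f x <= upper_sum f T n.
Proof.
move=> T0 ndf; pose t (i : nat) := T * i%:R / n.+1%:R.
have t0 : t 0%N = 0 by rewrite /t mulr0 mul0r.
have tn : t n.+1 = T by rewrite /t mulfK.
have ndt : {homo t : i j / (i <= j)%N >-> i <= j}.
  by move=> i j ij; rewrite /t ler_wpM2r// ler_wpM2l// ler_nat.
have step i : t i.+1 - t i = T / n.+1%:R.
  by rewrite /t -natr1; ring.
have := @Rintegral_nondecreasing_bounds _ f t n.+1 ndt.
rewrite t0 tn => /(_ ndf).
have upperE : \sum_(i < n.+1) (t i.+1 - t i) * f (t i.+1) = upper_sum f T n.
  by rewrite /upper_sum mulr_sumr; apply: eq_bigr => i _; rewrite step.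
have lowerE : \sum_(i < n.+1) (t i.+1 - t i) * f (t i) =
    upper_sum f T n - T * (f T - f 0) / n.+1%:R.
  have shift : \sum_(i < n.+1) f (t i.+1) = f T - f 0 + \sum_(i < n.+1) f (t i).
    by rewrite big_ord_recr big_ord_recl/= t0 tn; ring.
  under eq_bigr do rewrite step.
  by rewrite -mulr_sumr /upper_sum shift; ring.
by rewrite upperE lowerE.
Qed.

Lemma cvg_upper_sum (R : realType) (f : R -> R) (T : R) :
  0 <= T -> {in `[0, T] &, {homo f : x y / x <= y}} ->
  upper_sum f T n @[n --> \oo] --> \int[lebesgue_measure]_(x in `[0, T]) f x.
Proof.
move=> T0 ndf; set I := \int[_]_(_ in _) _.
have errC : I + T * (f T - f 0) / n.+1%:R @[n --> \oo] --> I.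
  rewrite -[X in _ --> X]addr0 -[X in _ --> _ + X](mulr0 (T * (f T - f 0))).
  by apply: cvgD; [exact: cvg_cst|apply: cvgMr; exact: cvg_harmonic].
apply: (squeeze_cvgr _ (cvg_cst I) errC); near=> n.
by have /andP[lo ->] := upper_sum_bounds n T0 ndf; rewrite /= -lerBlDr.
Unshelve. all: end_near. Qed.

(** * Exponential moments of Poisson increments *)

Lemma sum_poisson_pmf (R : realType) (m : R) : 0 < m ->
  (\sum_(k <oo) (poisson_pmf m k)%:E = 1)%E.
Proof.
move=> m0; rewrite -[RHS](probability_setT (poisson_prob m 0)).
transitivity (\esum_(k in [set: nat]) (poisson_pmf m k)%:E)%E.
  by apply: nneseries_esumT => k; rewrite lee_fin poisson_pmf_ge0.
by rewrite /= /poisson_prob m0.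
Qed.

(** Exponential tilting: weighting the Poisson law of parameter m by e^(a k)
gives, up to the normalizing factor, the Poisson law of parameter m e^a. *)
Lemma poisson_mgf (R : realType) (m a : R) : 0 < m ->
  (\sum_(k <oo) (expR (a * k%:R) * poisson_pmf m k)%:E
    = (expR (m * (expR a - 1)))%:E)%E.
Proof.
move=> m0; have ma0 : 0 < m * expR a by rewrite mulr_gt0// expR_gt0.
have tilt k : (expR (a * k%:R) * poisson_pmf m k)%:E =
    ((expR (m * (expR a - 1)))%:E * (poisson_pmf (m * expR a) k)%:E)%E.
  rewrite -EFinM /poisson_pmf m0 ma0; congr EFin.
  rewrite expRM_natr mulrBr mulr1 expRB expRN expRN exprMn_comm; last first.
    exact: mulrC.
  by field; rewrite !gt_eqF ?expR_gt0// ltr0n fact_gt0.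
under eq_eseriesr do rewrite tilt.
rewrite nneseriesZl; last by move=> k _; rewrite lee_fin poisson_pmf_ge0.
by rewrite sum_poisson_pmf// mule1.
Qed.

Lemma eseries_single (R : realType) (f : nat -> \bar R) (k : nat) :
  (forall j, j != k -> f j = 0%E) -> (\sum_(j <oo) f j = f k)%E.
Proof.
move=> f0; apply: lim_near_cst => //; near=> n.
rewrite big_mkord (bigD1 (Ordinal (_ : (k < n)%N)))//=.
  by near: n; exact: nbhs_infty_gt.
move=> kn; rewrite big1 ?adde0// => i ik; apply: f0.
by apply: contraNneq ik => ik; apply/eqP/val_inj.
Unshelve. all: end_near. Qed.

Lemma nneseriesZl_ereal (R : realType) (f : nat -> \bar R) (c : \bar R) :
  (0 <= c)%E -> (forall k, 0 <= f k)%E ->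
  (\sum_(k <oo) c * f k = c * \sum_(k <oo) f k)%E.
Proof.
move=> c0 f0; rewrite -!ge0_integral_count//; last by move=> k; exact: mule_ge0.
by rewrite ge0_integralZl.
Qed.

(** Interpolates between the functions f (at m = n) and the indicators of the
points k i (at m = 0), one index at a time. *)
Definition hybrid (R : realType) (n m : nat) (f : 'I_n -> nat -> R)
    (k : 'I_n -> nat) (i : 'I_n) : nat -> R :=
  if (i < m)%N then f i else fun x => (x == k i)%:R.

Lemma hybrid_ge0 (R : realType) (n m : nat) (f : 'I_n -> nat -> R)
    (k : 'I_n -> nat) (i : 'I_n) (x : nat) :
  (forall i x, 0 <= f i x) -> 0 <= hybrid m f k i x.
Proof. by move=> f0; rewrite /hybrid; case: ifP. Qed.

(** Independence is a product rule for events. When every factor is the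
indicator of a point, the formula is that rule. The general factors are then
restored one by one: f = sum_x f(x) 1_{x}, and both sides are linear in each
factor, also for infinite nonnegative sums. The sums may be infinite, so the
identity is stated between extended reals. *)
Lemma expectation_prod_independent (d : measure_display)
    (Omega : measurableType d) (R : realType) (P : probability Omega R)
    (n : nat) (X : 'I_n -> Omega -> nat) (f : 'I_n -> nat -> R) :
  (forall i, measurable_fun setT (X i)) ->
  mutually_independent P X -> (forall i x, 0 <= f i x) ->
  (\int[P]_w (\prod_i f i (X i w))%:E
    = \prod_i \sum_(k <oo) (f i k)%:E * P (X i @^-1` [set k]))%E.
Proof.
move=> mX indep f0.
have mpre i (A : set nat) : measurable (X i @^-1` A).
  by rewrite -[X in measurable X]setTI; exact: mX.
have mg (g : 'I_n -> nat -> R) :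
    measurable_fun setT (fun w => \prod_i g i (X i w) : R).
  apply: measurable_prod => i _.
  exact: (measurableT_comp _ (mX i)).
have main m (k : 'I_n -> nat) : (m <= n)%N ->
  (\int[P]_w (\prod_i hybrid m f k i (X i w))%:E
    = \prod_i \sum_(x <oo) (hybrid m f k i x)%:E * P (X i @^-1` [set x]))%E.
  elim: m k => [|m IHm] k mn.
    transitivity (P (\bigcap_i (X i @^-1` [set k i]))).
      rewrite -[X in P X]setIT -integral_indic//; last first.
        exact: fin_bigcap_measurable.
      apply: eq_integral => w _; congr EFin; rewrite indicE.
      have [/forallP Xk|] := boolP [forall i, X i w == k i].
        rewrite mem_set; last by move=> i _; exact/eqP/Xk.
        by apply: big1 => i _; rewrite /hybrid/= Xk.
      rewrite negb_forall => /existsP[i Xki].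
      rewrite memNset; last first.
        by move=> Xk; move: Xki; rewrite (Xk i Logic.I) eqxx.
      by rewrite (bigD1 i)//= /hybrid/= (negbTE Xki) mul0r.
    rewrite indep//; apply: eq_bigr => i _.
    rewrite (@eseries_single _ _ (k i)) /hybrid/= ?eqxx ?mul1e// => j jk.
    by rewrite (negbTE jk) mul0e.
  (* The factor of index o = m is expanded over its values x; in the term of x,
     it becomes the indicator of x, which is the induction hypothesis with k
     changed at o. *)
  pose o := Ordinal mn; pose upd x i := if i == o then x else k i.
  have hyb_o : hybrid m.+1 f k o = f o by rewrite /hybrid ltnSn.
  have hyb_upd_o x : hybrid m f (upd x) o = fun y => (y == x)%:R.
    by rewrite /hybrid /upd ltnn eqxx.
  have hyb_upd x i : i != o -> hybrid m f (upd x) i = hybrid m.+1 f k i.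
    move=> io; rewrite /hybrid /upd (negbTE io) ltnS [(i <= m)%N]leq_eqVlt.
    by rewrite -val_eqE/= in io; rewrite (negbTE io).
  have expand w : ((\prod_i hybrid m.+1 f k i (X i w))%:E =
      \sum_(x <oo) (f o x)%:E *
        (\prod_i hybrid m f (upd x) i (X i w))%:E)%E.
    rewrite (@eseries_single _ _ (X o w)).
      rewrite (bigD1 o)//= hyb_o EFinM [in RHS](bigD1 o)//=.
      rewrite hyb_upd_o eqxx mul1r; congr (_ * _%:E)%E.
      by apply: eq_bigr => i io; rewrite hyb_upd.
    move=> x xX; rewrite (bigD1 o)//= hyb_upd_o eq_sym (negbTE xX).
    by rewrite mul0r mule0.
  under eq_integral do rewrite expand.
  rewrite integral_nneseries//; last 2 first.
  - move=> x; apply/measurable_EFinP.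
    exact: (measurable_funM (measurable_cst _) (mg _)).
  - move=> x w _; rewrite lee_fin mulr_ge0// prodr_ge0// => i _.
    exact: hybrid_ge0.
  under eq_eseriesr => x _.
    rewrite ge0_integralZl_EFin//; last 2 first.
    - by move=> w _; rewrite lee_fin prodr_ge0// => i _; exact: hybrid_ge0.
    - exact/measurable_EFinP.
    rewrite (IHm (upd x) (ltnW mn)) (bigD1 o)//= hyb_upd_o.
    rewrite (@eseries_single _ _ x); last first.
      by move=> y yx; rewrite (negbTE yx) mul0e.
    rewrite eqxx mul1e.
    under eq_bigr => i io do under eq_eseriesr do rewrite hyb_upd//.
    rewrite muleA muleC.
    over.
  rewrite nneseriesZl_ereal; last 2 first.
  - rewrite prode_ge0// => i _; apply: nneseries_ge0 => x _ _.
    by rewrite mule_ge0// lee_fin hybrid_ge0.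
  - by move=> x; rewrite mule_ge0// lee_fin.
  by rewrite [in RHS](bigD1 o)//= hyb_o muleC.
have := main n (fun=> 0%N) (leqnn n).
have hyb_n i : hybrid n f (fun=> 0%N) i = f i by rewrite /hybrid ltn_ord.
by under eq_integral do under eq_bigr do rewrite hyb_n;
  move=> ->; apply: eq_bigr => i _; rewrite hyb_n.
Qed.

Lemma measurable_increment (d : measure_display) (Omega : measurableType d)
    (R : realType) (P : probability Omega R) (N : R -> {RV P >-> nat}) (s t : R) :
  measurable_fun setT (fun w => N t w - N s w)%N.
Proof. by apply: measurable_fun_subn; exact: measurable_funPT. Qed.

(** Independence factors the exponential moment over the increments. *)
Lemma poisson_increments_mgf (d : measure_display) (Omega : measurableType d)
    (R : realType) (P : probability Omega R) (rate : R) (N : R -> {RV P >-> nat})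
    (n : nat) (t : nat -> R) (a : 'I_n -> R) :
  poisson_process rate N -> 0 < rate -> 0 <= t 0%N ->
  (forall i, (i < n)%N -> t i < t i.+1) ->
  (\int[P]_w (expR (\sum_(i < n) a i * (N (t i.+1) w - N (t i) w)%N%:R))%:E
    = (expR (\sum_(i < n) rate * (t i.+1 - t i) * (expR (a i) - 1)))%:E)%E.
Proof.
move=> pN rate0 t0 t_incr.
have t_ge0 i : (i <= n)%N -> 0 <= t i.
  elim: i => // i IHi i_n.
  exact: le_trans (IHi (ltnW i_n)) (ltW (t_incr i i_n)).
under eq_integral do rewrite expR_sum.
rewrite (@expectation_prod_independent _ _ _ _ _
  (fun i w => N (t i.+1) w - N (t i) w)%N (fun i x => expR (a i * x%:R))).
- rewrite expR_sum -prodEFin; apply: eq_bigr => i _.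
  have law k : P ((fun w => N (t i.+1) w - N (t i) w)%N @^-1` [set k]) =
      (poisson_pmf (rate * (t i.+1 - t i)) k)%:E.
    apply: (poisson_process_increment_law pN); last exact: t_incr.
    exact/t_ge0/ltnW.
  under eq_eseriesr do rewrite law -EFinM.
  by rewrite poisson_mgf// mulr_gt0// subr_gt0 t_incr.
- by move=> i; exact: measurable_increment.
- exact: (poisson_process_independent_increments pN).
- by move=> i x; exact: expR_ge0.
Qed.

(** * Tail of the integral of a Poisson process *)

Lemma sum_by_parts (R : realType) (f : nat -> R) (n : nat) :
  \sum_(i < n) f i.+1 = n%:R * f 0%N + \sum_(i < n) (n - i)%:R * (f i.+1 - f i).
Proof.
elim: n => [|n IHn]; first by rewrite !big_ord0 mul0r addr0.
have diff : \sum_(i < n.+1) (f i.+1 - f i) = f n.+1 - f 0%N.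
  by rewrite -(big_mkord xpredT (fun i => f i.+1 - f i)) telescope_sumr.
have -> : \sum_(i < n.+1) (n.+1 - i)%:R * (f i.+1 - f i) =
    \sum_(i < n) (n - i)%:R * (f i.+1 - f i) + (f n.+1 - f 0%N).
  rewrite -diff !big_ord_recr/= subSnn mul1r [RHS]addrA -big_split/=.
  congr (_ + _).
  by apply: eq_bigr => i _; rewrite (subSn (ltnW (ltn_ord i))) -natr1; ring.
by rewrite big_ord_recr/= IHn -natr1; ring.
Qed.

Lemma mfun_natr_measurable (d : measure_display) (Omega : measurableType d)
    (R : realType) (X : {mfun Omega >-> nat}) :
  measurable_fun setT (fun w => (X w)%:R : R).
Proof. exact: measurableT_comp (measurable_funPT X). Qed.

Lemma poisson_process_homo (d : measure_display) (Omega : measurableType d)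
    (R : realType) (P : probability Omega R) (rate : R) (N : R -> {RV P >-> nat})
    (T : R) (w : Omega) : poisson_process rate N ->
  {in `[0, T] &, {homo (fun t => (N t w)%:R : R) : x y / x <= y}}.
Proof.
move=> pN x y /=; rewrite in_itv/= => /andP[x0 _] _ xy.
by rewrite ler_nat (poisson_process_nondecreasing pN).
Qed.

Lemma measurable_upper_sum (d : measure_display) (Omega : measurableType d)
    (R : realType) (P : probability Omega R) (N : R -> {RV P >-> nat})
    (T : R) (n : nat) :
  measurable_fun setT (fun w => upper_sum (fun t => (N t w)%:R) T n).
Proof.
apply: measurable_funM => //; apply: measurable_sum => i.
exact: mfun_natr_measurable.
Qed.

(** The integral is the pointwise limit of the upper sums, each of which
involves finitely many of the random variables N t. *)
Lemma measurable_time_integral (d : measure_display) (Omega : measurableType d)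
    (R : realType) (P : probability Omega R) (rate : R) (N : R -> {RV P >-> nat})
    (T : R) : poisson_process rate N -> 0 <= T ->
  measurable_fun setT
    (fun w => \int[lebesgue_measure]_(t in `[0, T]) (N t w)%:R : R).
Proof.
move=> pN T0; apply: measurable_fun_cvg (measurable_upper_sum N T) _.
by move=> w _; apply: cvg_upper_sum => //; exact: poisson_process_homo pN.
Qed.

(** Summation by parts writes the upper sum as a weighted sum of independent
increments, up to the term in N 0, which vanishes almost surely. The exponent
obtained is an upper Riemann sum of the exponential, which is then replaced by
the bound of upper_riemann_expR_le. *)
Lemma poisson_upper_sum_mgf (d : measure_display) (Omega : measurableType d)
    (R : realType) (P : probability Omega R) (N : R -> {RV P >-> nat})
    (T l : R) (n : nat) : poisson_process 1 N -> 0 < T -> 0 < l ->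
  (\int[P]_w (expR (l / T * upper_sum (fun t => (N t w)%:R) T n))%:E
    <= (expR (T * (expR (l / n.+1%:R) * ((expR l - 1) / l) - 1)))%:E)%E.
Proof.
move=> pN T0 l0; pose t (i : nat) := T * i%:R / n.+1%:R.
have t0 : t 0%N = 0 by rewrite /t mulr0 mul0r.
have step i : t i.+1 - t i = T / n.+1%:R by rewrite /t -natr1; ring.
have t_incr i : (i < n.+1)%N -> t i < t i.+1.
  by move=> _; rewrite -subr_gt0 step divr_gt0.
pose a (i : 'I_n.+1) : R := l * (n.+1 - i)%:R / n.+1%:R.
have by_parts : {ae P, forall w,
    l / T * upper_sum (fun t => (N t w)%:R) T n =
    \sum_(i < n.+1) a i * (N (t i.+1) w - N (t i) w)%N%:R}.
  apply: filterS (poisson_process_start pN) => w N0.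
  rewrite /upper_sum -/(t _) (sum_by_parts (fun i => (N (t i) w)%:R)).
  rewrite t0 N0 mulr0 add0r !mulr_sumr; apply: eq_bigr => i _.
  have N_incr : (N (t i) w <= N (t i.+1) w)%N.
    apply: (poisson_process_nondecreasing pN); last exact/ltW/t_incr.
    by rewrite /t divr_ge0// mulr_ge0// ltW.
  rewrite (natrB _ N_incr).
  by rewrite /a; set u := (_ - _)%:R; field; rewrite nat1r pnatr_eq0 (gt_eqF T0).
apply: (@le_trans _ _ (\int[P]_w
    (expR (\sum_(i < n.+1) a i * (N (t i.+1) w - N (t i) w)%N%:R))%:E)%E).
  apply: ae_ge0_le_integral => //.
  - apply/measurable_EFinP; apply: measurableT_comp => //.
    by apply: measurable_funM => //; exact: measurable_upper_sum.
  - apply/measurable_EFinP; apply: measurableT_comp => //.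
    apply: measurable_sum => i; apply: measurable_funM => //.
    exact: measurableT_comp (measurable_increment _ _ _).
  - by apply: filterS by_parts => w -> _; rewrite lexx.
rewrite (poisson_increments_mgf _ pN) ?t0// lee_fin ler_expR.
under eq_bigr do rewrite step mul1r.
rewrite -mulr_sumr mulrAC -mulrA ler_pM2l// sumrB mulrBl.
rewrite sumr_const card_ord -[_ *+ _]mulr_natr mul1r divff// lerB//.
apply: le_trans (upper_riemann_expR_le n l0).
(* The weights decrease along the grid, the Riemann sum is read from left to
   right: the indices are reversed. *)
rewrite (reindex_inj rev_ord_inj)/= /a ler_wpM2r//.
by apply: ler_sum => i _; rewrite [val (rev_ord i)]/= subKn.
Qed.

(** Markov's inequality in integrated form: the indicator of the event is at
most exp(l (U/T - c)), where U is the upper sum, since U dominates the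
integral. *)
Lemma poisson_upper_sum_tail (d : measure_display) (Omega : measurableType d)
    (R : realType) (P : probability Omega R) (N : R -> {RV P >-> nat})
    (T l c : R) (n : nat) : poisson_process 1 N -> 0 < T -> 0 < l ->
  (P [set w | (c <= T^-1 * \int[lebesgue_measure]_(t in `[0, T]) (N t w)%:R)%R]
    <= (expR (T * (expR (l / n.+1%:R) * ((expR l - 1) / l) - 1) - l * c))%:E)%E.
Proof.
move=> pN T0 l0; set A := [set w | _].
have mA : measurable A.
  rewrite /A -[X in measurable X]setTI.
  apply: measurable_fun_ler => //; apply: measurable_funM => //.
  exact: measurable_time_integral pN (ltW T0).
have mU : measurable_fun setT
    (fun w => l / T * upper_sum (fun t => (N t w)%:R) T n).
  by apply: measurable_funM => //; exact: measurable_upper_sum.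
rewrite expRB mulrC EFinM -[A]setIT -integral_indic//.
apply: le_trans (lee_wpmul2l _ (poisson_upper_sum_mgf n pN T0 l0)).
  rewrite -ge0_integralZl_EFin//; last first.
    by apply/measurable_EFinP; exact: measurableT_comp mU.
  apply: ge0_le_integral => //.
  - by apply/measurable_EFinP; exact: measurable_indic.
  - apply/measurable_EFinP; apply: measurable_funM => //.
    exact: measurableT_comp mU.
  - move=> w _; rewrite lee_fin -expRN -expRD indicE.
    have [/set_mem Aw|_] := boolP (w \in A); last exact: expR_ge0.
    rewrite -[leLHS]expR0 ler_expR addrC subr_ge0 -mulrA ler_pM2l//.
    apply: le_trans Aw _; rewrite ler_pM2l ?invr_gt0//.
    have homoN := poisson_process_homo (T := T) w pN.
    by have /andP[] := upper_sum_bounds n (ltW T0) homoN.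
by rewrite lee_fin invr_ge0 expR_ge0.
Qed.

(** The bound of poisson_upper_sum_tail holds for all n, and e^(l / n.+1) tends
to 1. *)
Lemma poisson_integral_tail (d : measure_display) (Omega : measurableType d)
    (R : realType) (P : probability Omega R) (N : R -> {RV P >-> nat})
    (T l c : R) : poisson_process 1 N -> 0 < T -> 0 < l ->
  (P [set w | (c <= T^-1 * \int[lebesgue_measure]_(t in `[0, T]) (N t w)%:R)%R]
    <= (expR (T * ((expR l - 1) / l - 1) - l * c))%:E)%E.
Proof.
move=> pN T0 l0; set A := [set w | _].
have tail n := poisson_upper_sum_tail c n pN T0 l0.
have PA_fin : P A \is a fin_num.
  by rewrite ge0_fin_numE// (le_lt_trans (tail 0%N))// ltry.
rewrite -(fineK PA_fin) lee_fin.
set B := fun n : nat =>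
  expR (T * (expR (l / n.+1%:R) * ((expR l - 1) / l) - 1) - l * c).
have B_cvg : B n @[n --> \oo] --> expR (T * ((expR l - 1) / l - 1) - l * c).
  have e1 : expR (l / n.+1%:R) @[n --> \oo] --> (1 : R).
    rewrite -[X in _ --> X]expR0; apply: continuous_cvg.
      exact: continuous_expR.
    by rewrite -[X in _ --> X](mulr0 l); apply: cvgMr; exact: cvg_harmonic.
  have e2 : T * (expR (l / n.+1%:R) * ((expR l - 1) / l) - 1) - l * c
      @[n --> \oo] --> T * (1 * ((expR l - 1) / l) - 1) - l * c.
    apply: cvgB; last exact: cvg_cst.
    apply: cvgMr; apply: cvgB; last exact: cvg_cst.
    exact: cvgMl.
  rewrite mul1r in e2.
  exact: (cvg_comp _ _ e2 (@continuous_expR R _)).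
rewrite -(cvg_lim _ B_cvg)//; apply: limr_ge; first exact: cvgP B_cvg.
by apply: nearW => n; rewrite -lee_fin (fineK PA_fin); exact: tail.
Qed.

Unset Implicit Arguments.

Theorem proposition4p12 (d : measure_display) (Omega : measurableType d)
    (R : realType) (P : probability Omega R) (N : R -> {RV P >-> nat})
    (poissonN : poisson_process 1 N) (r T : R) (r_gt0 : 0 < r) (T_gt0 : 0 < T) :
  (P [set w | ((T ^+ 2)^-1
                * (\int[lebesgue_measure]_(t in `[0, T]) (N t w)%:R) - 2^-1 >= r)%R]
     <= (expR (- (T / 3) * bennett_h (3 * r)))%:E
     <= (expR (- (3 * r ^+ 2 * T / (2 * (1 + r)))))%:E)%E.
Proof.
apply/andP; split.
  (* The minimizer of e^l - 1 - l - 3 r l. *)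
  pose l := ln (1 + 3 * r).
  have l0 : 0 < l by rewrite ln_gt0//; lra.
  have expl : expR l = 1 + 3 * r by rewrite lnK//; apply: addr_gt0; lra.
  have -> : [set w | ((T ^+ 2)^-1 * (\int[lebesgue_measure]_(t in `[0, T])
        (N t w)%:R) - 2^-1 >= r)%R] =
      [set w | (T * (r + 2^-1) <= T^-1 *
        \int[lebesgue_measure]_(t in `[0, T]) (N t w)%:R)%R].
    apply/funext => w; congr is_true.
    by rewrite lerBrDr expr2 invfM -mulrA ler_pdivlMl.
  apply: le_trans (poisson_integral_tail _ poissonN T_gt0 l0) _.
  rewrite lee_fin ler_expR /bennett_h -/l.
  have := uniform_mgf_le l0; rewrite expl => mgf.
  have := ler_wpM2l (ltW T_gt0) mgf.
  lra.
rewrite lee_fin ler_expR mulNr lerN2.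
have -> : 3 * r ^+ 2 * T / (2 * (1 + r)) =
    T / 3 * ((3 * r) ^+ 2 / (2 * (1 + 3 * r / 3))).
  by field; rewrite gt_eqF//; lra.
apply: ler_wpM2l; first by rewrite divr_ge0// ltW.
by apply: bennett_h_ge; rewrite mulr_ge0// ltW.
Qed.
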